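(* Let $n\ge 2$ be an integer and $t\in[-1,1)$. Let $A\in C(\mathcal{I}_1^3)$ be positive semidefinite and such that \[ (B_3A)(\{x\})\le -1\ \text{ for all } x\in S^{n-1},\qquad (B_3A)(S)\le 0\ \text{ for all } S\in\mathcal{I}_3 \text{ with } |S|\ge 2 . \] Then $\alpha(H(n,t))\le (B_3A)(\emptyset)$.
   Context: $S^{n-1}=\{x\in\mathbb{R}^n:\|x\|=1\}$ and $x\cdot y$ is the Euclidean inner product. $H(n,t)$ is the $3$-uniform hypergraph with vertex set $S^{n-1}$ in which a set $\{x,y,z\}$ of three distinct points is an edge if $t\notin\{x\cdot y,\,x\cdot z,\,y\cdot z\}$. A subset of $S^{n-1}$ is independent if it contains no edge of $H(n,t)$, and $\alpha(H(n,t))$ is the maximum cardinality of an independent set. $\mathcal{I}_k$ is the set of all independent sets of $H(n,t)$ of cardinality at most $k$ (including $\emptyset$). In particular $\mathcal{I}_1=\{\emptyset\}\cup\{\{x\}:x\in S^{n-1}\}$, which is given the topology of the disjoint union of an isolated point $\emptyset$ and the sphere $S^{n-1}$; $C(\mathcal{I}_1^3)$ is the set of continuous real-valued functions on $\mathcal{I}_1\times\mathcal{I}_1\times\mathcal{I}_1$. A function $A\in C(\mathcal{I}_1^3)$ is called positive semidefinite if for every $Q\in\mathcal{I}_1$ the kernel $(S,T)\mapsto A(S,T,Q)$ is positive semidefinite, i.e., for every finite $U\subseteq\mathcal{I}_1$ the matrix $(A(S,T,Q))_{S,T\in U}$ is positive semidefinite. For $I\in\mathcal{I}_3$, \[ (B_3A)(I):=\sum_{\substack{S,T,Q\in\mathcal{I}_1\\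 S\cup T\cup Q=I}}A(S,T,Q). \] *)

(* Defs.v *)
From HB Require Import structures.
From mathcomp Require Import all_boot all_order all_algebra.
From mathcomp Require Import all_classical all_reals all_analysis.

Set Implicit Arguments.
Unset Strict Implicit.
Unset Printing Implicit Defensive.

Import Order.TTheory GRing.Theory Num.Theory.
Import numFieldNormedType.Exports.

Local Open Scope classical_set_scope.
Local Open Scope card_scope.
Local Open Scope ring_scope.

(* The norm that MathComp-Analysis puts on 'rV[R]_n is the sup norm, so the
   Euclidean inner product and norm are defined here.  Both norms induce the
   same topology. *)
Definition dotv (R : realType) (n : nat) (x y : 'rV[R]_n) : R :=
  (x *m y^T) 0 0.

Definition enorm (R : realType) (n : nat) (x : 'rV[R]_n) : R :=
  Num.sqrt (dotv x x).

(* [sphere R n] is S^(n-1); used as a type it is the subtype of 'rV[R]_n with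
   the induced topology. *)
Definition sphere (R : realType) (n : nat) : set 'rV[R]_n :=
  [set x | enorm x = 1].
Arguments sphere : clear implicits.

Definition dots (R : realType) (n : nat) (x y : sphere R n) : R :=
  dotv (val x) (val y).

(* The edges of the hypergraph H(n,t). *)
Definition hedge (R : realType) (n : nat) (t : R) : set (set (sphere R n)) :=
  [set e | exists x y z : sphere R n,
     [/\ x <> y, x <> z, y <> z, e = [set x; y; z] &
       ~ [set dots x y; dots x z; dots y z] t] ].

Definition indep (R : realType) (n : nat) (t : R) : set (set (sphere R n)) :=
  [set I | forall e, hedge t e -> ~ e `<=` I].

Definition indep_le (R : realType) (n : nat) (t : R) (k : nat) :
    set (set (sphere R n)) :=
  [set I | indep t I /\ I #<= `I_k].

(* The cardinality of an infinite set is +oo here; by [alpha_attained] below the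
   supremum is a maximum as soon as it is finite. *)
Definition alpha (R : realType) (n : nat) (t : R) : \bar R :=
  ereal_sup [set counting I | I in @indep R n t].

(* The space I_1: the disjoint union of a point, standing for the empty set, and
   of the sphere, whose points stand for the singletons. *)
Definition I1_summand (R : realType) (n : nat) (b : bool) : topologicalType :=
  if b then sphere R n : topologicalType else discrete_topology unit.

Definition I1 (R : realType) (n : nat) : topologicalType :=
  {b : bool & I1_summand R n b}.

Definition I1empty (R : realType) (n : nat) : I1 R n :=
  existT (I1_summand R n) false tt.

Definition I1pt (R : realType) (n : nat) (x : sphere R n) : I1 R n :=
  existT (I1_summand R n) true x.

Definition I1set (R : realType) (n : nat) (S : I1 R n) : set (sphere R n) :=
  match S with
  | existT true x => [set (x : sphere R n)]
  | existT false _ => set0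
  end.

Definition psdmx (R : realType) (m : nat) (M : 'M[R]_m) : Prop :=
  M^T = M /\ forall c : 'rV[R]_m, 0 <= (c *m M *m c^T) 0 0.

(* A finite set of points of T is given by an injective enumeration. *)
Definition psd_kernel (R : realType) (T : Type) (K : T -> T -> R) : Prop :=
  forall (m : nat) (u : 'I_m -> T), injective u ->
    psdmx (\matrix_(i, j) K (u i) (u j)).

Definition psd3 (R : realType) (n : nat)
    (A : I1 R n -> I1 R n -> I1 R n -> R) : Prop :=
  forall Q : I1 R n, psd_kernel (fun S T => A S T Q).

Definition continuous3 (R : realType) (n : nat)
    (A : I1 R n -> I1 R n -> I1 R n -> R) : Prop :=
  continuous (fun p : I1 R n * I1 R n * I1 R n => A p.1.1 p.1.2 p.2).

(* The index set is finite whenever I is, see [B3_index_finite]; on infinite I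
   the value of [B3] is irrelevant. *)
Definition B3_index (R : realType) (n : nat) (I : set (sphere R n)) :
    set (I1 R n * I1 R n * I1 R n) :=
  [set p | I1set p.1.1 `|` I1set p.1.2 `|` I1set p.2 = I].

Definition B3 (R : realType) (n : nat)
    (A : I1 R n -> I1 R n -> I1 R n -> R) (I : set (sphere R n)) : R :=
  \sum_(p \in B3_index I) A p.1.1 p.1.2 p.2.

Lemma I1set_inj (R : realType) (n : nat) : injective (@I1set R n).
Proof.
move=> [[] x] [[] y] /= e.
- by have -> : x = y by have : [set x] x by []; rewrite e.
- by have : [set (x : sphere R n)] x by []; rewrite e.
- by have : [set (y : sphere R n)] y by []; rewrite -e.
- by case: x y {e} => -[].
Qed.

Lemma range_I1set (R : realType) (n : nat) (t : R) :
  range (@I1set R n) = indep_le t 1.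
Proof.
apply/seteqP; split => [_ [S _ <-]|I [_ cI]].
- have S1 : I1set S #<= `I_1.
    case: S => -[] x /=; last exact: card_ge0.
    by rewrite (card_le_eql card_set1).
  split=> // e [x [y [z [xy _ _ -> _]]]] sS.
  have Sx : I1set S x by apply: sS; left; left.
  have Sy : I1set S y by apply: sS; left; right.
  case: S {S1 sS} Sx Sy => -[] u //= xu yu.
  by apply: xy; rewrite xu yu.
- have [->|/set0P[x Ix]] := eqVneq I set0; first by exists (I1empty R n).
  exists (I1pt x) => //=; apply/seteqP; split => [_ ->//|y Iy] /=.
  move: cI => /pcard_leP[f].
  apply: (@inj _ _ _ f); rewrite ?inE //.
  have := @funS _ _ _ _ f _ Ix; have := @funS _ _ _ _ f _ Iy => /=.
  by case: (f x) => //; case: (f y).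
Qed.

Lemma B3_index_finite (R : realType) (n : nat) (I : set (sphere R n)) :
  finite_set I -> finite_set (B3_index I).
Proof.
move=> fI; pose J := [set I1empty R n] `|` @I1pt R n @` I.
have fJ : finite_set J.
  by rewrite finite_setU; split; [exact: finite_set1|exact: finite_image].
have sJ (S : I1 R n) : I1set S `<=` I -> J S.
  case: S => -[] x /= sS; last by left; case: x {sS}.
  by right; exists x => //; exact: sS.
apply: (@sub_finite_set _ _ ((J `*` J) `*` J)).
  by move=> -[[S T] Q] /= eI; split; [split|]; apply: sJ => x Sx;
     rewrite -eI; [left; left|left; right|right].
by do ?apply: finite_setX.
Qed.

Lemma alpha_attained (R : realType) (n : nat) (t : R) :
  (alpha n t < +oo)%E -> exists2 I : set (sphere R n), indep t I &
    alpha n t = counting I.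
Proof.
move=> afin; pose F : set (\bar R) := [set counting I | I in @indep R n t].
have F0 : F 0%E.
  exists set0; first by move=> e [x [y [z [_ _ _ -> _]]]] /(_ x) []; left; left.
  by rewrite /counting asboolT // fset_set0.
have age0 : (0 <= alpha n t)%E by exact: ereal_sup_ubound.
have aR : alpha n t \is a fin_num by rewrite ge0_fin_numE.
have [_ [I indI <-] ltI] := @ub_ereal_sup_adherent _ F 1 ltr01 aR.
exists I => //; apply/eqP; rewrite eq_le; apply/andP; split; last first.
  by apply: ereal_sup_ubound; exists I.
apply: ge_ereal_sup => _ [K indK <-].
have : (counting K <= alpha n t)%E by apply: ereal_sup_ubound; exists K.
move: ltI; rewrite -/(alpha n t) /counting; case: asboolP => _ //; last by
  rewrite leey.
case: asboolP => _; last by move=> _ /le_lt_trans/(_ afin).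
rewrite -(fineK aR) lee_fin -EFinB lte_fin => lt1 le1.
rewrite lee_fin ler_nat -ltnS -(ltr_nat R) -natr1.
by rewrite (le_lt_trans le1) // -ltrBlDr.
Qed.

(* Main.v *)
Require Import Defs.
From mathcomp Require Import all_boot all_order all_algebra.
From mathcomp Require Import all_classical all_reals all_analysis.
Import Order.TTheory GRing.Theory Num.Theory.
Import numFieldNormedType.Exports.
Local Open Scope classical_set_scope.
Local Open Scope card_scope.
Local Open Scope ring_scope.

(** Let I be a finite independent set of N points and add up A(S,T,Q) over all
    triples of subsets S, T, Q of I with at most one element.

    For a fixed Q the double sum over S and T is the quadratic form of a
    positive semidefinite matrix at the all-ones vector, so the total is
    nonnegative ([sum_B3_ge0]).  Grouping the triples by the union
    J = S `|` T `|` Q turns the same total into the sum of (B_3 A)(J) over all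
    subsets J of I ([B3_image]); those with more than three points contribute
    nothing.  The remaining J are independent, so the hypotheses apply: each of
    the N singletons contributes at most -1, each pair or triple at most 0, and
    the empty set contributes (B_3 A)(set0).  Hence
    0 <= (B_3 A)(set0) - N ([card_indep_le]).

    Every subset of an independent set is independent, so an infinite
    independent set would contain independent sets of every finite size, all
    bounded by the real number (B_3 A)(set0); thus the supremum runs over finite
    sets only. *)

(** The quadratic form of the kernel evaluated at the all-ones vector. *)
Lemma psd_kernel_sum_ge0 (R : realType) (T : Type) (F : finType)
    (K : T -> T -> R) (u : F -> T) :
  psd_kernel K -> injective u -> 0 <= \sum_s \sum_r K (u s) (u r).
Proof.
move=> psdK uI.
have vI : injective (u \o @enum_val F F) by apply: inj_comp uI enum_val_inj.
have [_ /(_ (const_mx 1))] := psdK _ _ vI.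
rewrite mxE; under eq_bigr => j _.
  rewrite !mxE mulr1; under eq_bigr => i _ do rewrite !mxE mul1r /=.
  over.
rewrite exchange_big /=.
rewrite (reindex (@enum_val F F)) /=; last first.
  exact/onW_bij/enum_val_bij.
congr (_ <= _); apply: eq_bigr => i _.
by rewrite [RHS](reindex (@enum_val F F)) //; apply/onW_bij/enum_val_bij.
Qed.

(** A finite set of points is handled as an injective family x indexed by a
    finite type F, so that its subsets are the images of the J : {set F}, and its
    subsets with at most one element are indexed by [option F]. *)
Section IndexedPoints.
Context {R : realType} {n : nat} {F : finType} (x : F -> sphere R n).
Context (x_inj : injective x).
Implicit Types (s : option F) (p : option F * option F * option F).
Implicit Type J : {set F}.

Definition I1idx s : I1 R n :=
  if s is Some i then I1pt (x i) else I1empty R n.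

Definition idxset s : {set F} :=
  if s is Some i then [set i]%SET else finset.set0.

Definition idxcup p : {set F} :=
  idxset p.1.1 :|: idxset p.1.2 :|: idxset p.2.

Lemma I1set_I1idx s : I1set (I1idx s) = x @` [set` idxset s].
Proof.
case: s => [i|] /=; apply/seteqP; split=> y //=.
- by move=> ->; exists i => //; rewrite inE.
- by move=> [j]; rewrite inE => /eqP -> <-.
- by move=> [j]; rewrite inE.
Qed.

Lemma I1idx_inj : injective I1idx.
Proof.
move=> [i|] [j|] //= e.
have /seteqP[/(_ (x i) erefl)] : I1set (I1pt (x i)) = I1set (I1pt (x j)).
  by rewrite e.
by move=> /= /x_inj ->.
Qed.

Lemma I1set_subP S J : I1set S `<=` x @` [set` J] -> exists s, S = I1idx s.
Proof.
case: S => -[] y /= sJ; last by exists None; case: y {sJ}.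
by have [i _ yE] := sJ y erefl; exists (Some i); rewrite /= yE.
Qed.

Lemma image_inj J J' : x @` [set` J] = x @` [set` J'] -> J = J'.
Proof.
move=> e; apply/setP => i; apply/idP/idP => iJ.
- by have [j jJ /x_inj <-] : (x @` [set` J']) (x i) by rewrite -e; exists i.
- by have [j jJ /x_inj <-] : (x @` [set` J]) (x i) by rewrite e; exists i.
Qed.

Lemma I1set_idxcup p :
  I1set (I1idx p.1.1) `|` I1set (I1idx p.1.2) `|` I1set (I1idx p.2) =
  x @` [set` idxcup p].
Proof.
rewrite !I1set_I1idx -!image_setU; congr (_ @` _).
apply/seteqP; split=> i /=; rewrite /idxcup !inE.
  by move=> [[]|] -> //; rewrite orbT.
by move=> /orP[/orP[]|] ->; [left; left|left; right|right].
Qed.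

Lemma card_idxcup p : (#|idxcup p| <= 3)%N.
Proof.
have h s : (#|idxset s| <= 1)%N by case: s => [i|] /=; rewrite ?cards1 ?cards0.
rewrite /idxcup; apply: leq_trans (leq_card_setU _ _) _.
rewrite (leq_add (n1:=2)) // (leq_trans (leq_card_setU _ _)) //.
exact: (leq_add (n1:=1)).
Qed.

Lemma card_eq_image J : x @` [set` J] #= `I_#|J|.
Proof.
rewrite (card_eql (inj_card_eq _)); last by move=> ? ? _ _; exact: x_inj.
have -> : [set` J] = range (@enum_val F J).
  apply/seteqP; split=> [i iJ|_ [k _ <-]]; last exact: enum_valP.
  by exists (enum_rank_in iJ i) => //; rewrite enum_rankK_in.
rewrite (card_eql (inj_card_eq _)) 1?card_eq_sym ?card_II //.
by move=> ? ? _ _; exact: enum_val_inj.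
Qed.

(** The constraint S `|` T `|` Q = x @` J forces S, T and Q to lie in x @` J, so
    the triples of I_1 that define B_3 are exactly those coming from triples of
    indices; injectivity of x makes this correspondence one-to-one. *)
Lemma B3_image A J :
  B3 A (x @` [set` J]) =
  \sum_(p | idxcup p == J) A (I1idx p.1.1) (I1idx p.1.2) (I1idx p.2).
Proof.
rewrite -big_filter fsbig_seq ?filter_uniq ?index_enum_uniq //.
rewrite /B3.
apply: (reindex_fsbig (fun p => (I1idx p.1.1, I1idx p.1.2, I1idx p.2))).
split.
- move=> p /=; rewrite mem_filter => /andP[/eqP <- _].
  by rewrite /B3_index /= I1set_idxcup.
- by move=> [[? ?] ?] [[? ?] ?] _ _ [] /= /I1idx_inj -> /I1idx_inj ->
    /I1idx_inj ->.
- move=> [[S T] Q]; rewrite /B3_index /= => e.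
  have [s sE] : exists s, S = I1idx s.
    by apply: (@I1set_subP _ J); rewrite -e => y; left; left.
  have [r rE] : exists s, T = I1idx s.
    by apply: (@I1set_subP _ J); rewrite -e => y; left; right.
  have [q qE] : exists s, Q = I1idx s.
    by apply: (@I1set_subP _ J); rewrite -e => y; right.
  exists (s, r, q); last by rewrite /= sE rE qE.
  rewrite /= mem_filter mem_index_enum andbT; apply/eqP/image_inj.
  by rewrite -e sE rE qE -(I1set_idxcup (s, r, q)).
Qed.

(** Grouping triples by their union covers every triple of indices once, and for
    each fixed third component the sum over the first two is nonnegative. *)
Lemma sum_B3_ge0 A : psd3 A -> 0 <= \sum_(J : {set F}) B3 A (x @` [set` J]).
Proof.
move=> psdA; under eq_bigr do rewrite B3_image.
rewrite -(partition_big (P := xpredT) idxcup xpredT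
  (F := fun p => A (I1idx p.1.1) (I1idx p.1.2) (I1idx p.2))) //=.
rewrite -(pair_bigA _ (fun a q => A (I1idx a.1) (I1idx a.2) (I1idx q))) /=.
rewrite exchange_big; apply: sumr_ge0 => q _.
rewrite -(pair_bigA _ (fun s r => A (I1idx s) (I1idx r) (I1idx q))) /=.
exact: psd_kernel_sum_ge0 (psdA _) I1idx_inj.
Qed.

(** Such a sum is empty: three sets of at most one element cannot cover J. *)
Lemma B3_image_gt3 A J : (3 < #|J|)%N -> B3 A (x @` [set` J]) = 0.
Proof.
move=> J3; rewrite B3_image big1 // => p /eqP pJ.
by move: (card_idxcup p); rewrite pJ leqNgt J3.
Qed.

End IndexedPoints.
Arguments sum_B3_ge0 {R n F x} _ {A}.
Arguments B3_image_gt3 {R n F x}.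
Arguments card_eq_image {R n F x}.

Lemma indep_sub (R : realType) (n : nat) (t : R) (I K : set (sphere R n)) :
  K `<=` I -> indep t I -> indep t K.
Proof. by move=> KI indI e he eK; apply: indI he _ => y /eK /KI. Qed.

(** The heart of the proof: among the subsets J of an independent set, the
    singletons pay for the number of points. *)
Lemma card_indep_le (R : realType) (n : nat) (t : R)
    (A : I1 R n -> I1 R n -> I1 R n -> R) (F : finType) (x : F -> sphere R n) :
  psd3 A -> (forall y : sphere R n, B3 A [set y] <= -1) ->
  (forall S, indep_le t 3 S -> `I_2 #<= S -> B3 A S <= 0) ->
  injective x -> indep t (range x) -> #|F|%:R <= B3 A set0.
Proof.
move=> psdA B1 B2 xI indx; have := sum_B3_ge0 xI psdA.
rewrite (bigD1 finset.set0) //=.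
have -> : x @` [set` (finset.set0 : {set F})] = set0.
  by apply/seteqP; split => // y [i]; rewrite /= inE.
move=> /le_trans h; rewrite -subr_ge0 h // lerD2l.
(* Write #|F| as the number of one-element J, to compare the two sums over the
   nonempty J term by term. *)
rewrite -[in leRHS](bin1 #|F|) -card_draws -sum1_card natr_sum -sumrN.
rewrite [leRHS]big_mkcond [leLHS]big_mkcond /=; apply: ler_sum => J _.
rewrite inE -cards_eq0 /=.
case: (ltngtP #|J| 1) => [|J1|J1].
- by rewrite ltnS leqn0 => ->.
- rewrite -lt0n (ltn_trans _ J1) //.
  have [J3|J3] := leqP #|J| 3; last by rewrite (B3_image_gt3 xI).
  apply: B2; last by rewrite (card_le_eqr (card_eq_image xI _)) card_le_II.
  split; last by rewrite (card_le_eql (card_eq_image xI _)) card_le_II.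
  by apply: indep_sub indx => y [i _ <-]; exists i.
- rewrite J1 /=; have /cards1P[i ->] : #|J| == 1%N by rewrite J1.
  have -> : x @` [set` [set i]%SET] = [set x i]; last exact: B1.
  apply/seteqP; split => [y [j]|y ->]; last by exists i; rewrite //= inE.
  by rewrite /= inE => /eqP -> <-.
Qed.

Theorem theorem3p1 (R : realType) (n : nat) (t : R)
    (A : I1 R n -> I1 R n -> I1 R n -> R)
    (hn : (2 <= n)%N) (ht : -1 <= t < 1)
    (A_cont : continuous3 A) (A_psd : psd3 A)
    (hA1 : forall x : sphere R n, B3 A [set x] <= -1)
    (hA2 : forall S : set (sphere R n),
       indep_le t 3 S -> `I_2 #<= S -> B3 A S <= 0) :
  (alpha n t <= (B3 A set0)%:E)%E.
Proof.
have bound (N : nat) (I : set (sphere R n)) :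
    indep t I -> `I_N #<= I -> N%:R <= B3 A set0.
  move=> indI; rewrite (card_le_eql card_II) => /card_leP[f].
  pose x (i : 'I_N) : sphere R n := set_val (f (to_setT i)).
  rewrite -[N in N%:R]card_ord; apply: (@card_indep_le _ _ t A _ x) => //.
    by move=> i j /val_inj /(@inj _ _ _ f); rewrite !inE
      => /(_ Logic.I Logic.I) /(congr1 set_val).
  by apply: indep_sub indI => y [i _ <-]; exact: set_valP.
apply: ge_ereal_sup => _ [I indI <-].
rewrite /counting; case: asboolP => [/finite_setP[N IN]|/infiniteP Iinf].
  rewrite (card_fset_set IN) lee_fin; apply: (bound _ _ indI).
  by rewrite (card_le_eqr IN).
(* An infinite I contains more than B3 A set0 points, against the bound. *)
have B0 : 0 <= B3 A set0 by apply: (bound 0%N I indI); rewrite II0 card_ge0.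
have := archi_boundP B0; rewrite ltNge => /negP[]; apply: (bound _ _ indI).
by apply: card_le_trans Iinf; apply: subset_card_le.
Qed.
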